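(* Let $N\geq 1$, let $A\in M_N(\mathbb{C})$ and let $0<\epsilon<1$. Then for all $\alpha,\beta\in\mathbb{C}$, $$\sigma_\epsilon(\alpha+\beta A)=\alpha+\beta\,\sigma_\epsilon(A),$$ where $\alpha+\beta A$ means $\alpha I+\beta A$ and $\alpha+\beta\,\sigma_\epsilon(A)=\{\alpha+\beta z: z\in\sigma_\epsilon(A)\}$.
   Context: $M_N(\mathbb{C})$ is the algebra of complex $N\times N$ matrices; $\|\cdot\|$ is the Euclidean norm on $\mathbb{C}^N$ and the induced operator norm (spectral norm) on $M_N(\mathbb{C})$. For a scalar $z$, $z-A$ means $zI-A$. For $0<\epsilon<1$ the $\epsilon$-condition spectrum of $A$ is $$\sigma_\epsilon(A)=\{z\in\mathbb{C}: z-A \text{ is not invertible, or } \|(z-A)^{-1}\|\,\|z-A\|\geq 1/\epsilon\}.$$ *)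

(* Defs.v *)
From mathcomp Require Import all_boot all_order all_algebra.
From mathcomp Require Import complex.
From mathcomp Require Import classical_sets reals.

Set Implicit Arguments.
Unset Strict Implicit.
Unset Printing Implicit Defensive.

Import Order.TTheory GRing.Theory Num.Theory.
Local Open Scope classical_set_scope.
Local Open Scope ring_scope.

(* Complex numbers are R[i] with R a realType; [Normc.normc] is the complex
   modulus with values in R (the norm `|z| of R[i] has values in R[i]). *)

Definition enorm (R : realType) (N : nat) (x : 'cV[R[i]]_N) : R :=
  Num.sqrt (\sum_(k < N) Normc.normc (x k ord0) ^+ 2).

(* [sup] is the true supremum here: the set is nonempty and bounded above, see
   [has_sup_opnorm]. *)
Definition opnorm (R : realType) (N : nat) (A : 'M[R[i]]_N) : R :=
  sup [set enorm (A *m x) | x in [set x : 'cV[R[i]]_N | enorm x <= 1]].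

Definition cond_spectrum (R : realType) (N : nat) (eps : R) (A : 'M[R[i]]_N) :
    set R[i] :=
  [set z | z%:M - A \notin unitmx \/
           opnorm (invmx (z%:M - A)) * opnorm (z%:M - A) >= 1 / eps].

Lemma has_sup_opnorm (R : realType) (N : nat) (A : 'M[R[i]]_N) :
  has_sup [set enorm (A *m x) | x in [set x : 'cV[R[i]]_N | enorm x <= 1]].
Proof.
have normc_ge0 (z : R[i]) : 0 <= Normc.normc z by case: z => a b; exact: sqrtr_ge0.
split.
  exists (enorm (A *m 0)); exists 0 => //=.
  rewrite /enorm big1 ?sqrtr0 // => k _.
  by rewrite mxE Normc.normc0 expr0n.
exists (Num.sqrt (\sum_(k < N) (\sum_(j < N) Normc.normc (A k j)) ^+ 2)).
move=> _ [x /= x1 <-]; rewrite /enorm ler_wsqrtr //; apply: ler_sum => k _.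
rewrite lerXn2r ?nnegrE ?sumr_ge0 // mxE.
have coord1 j : Normc.normc (x j ord0) <= 1.
  apply: le_trans x1; rewrite -[leLHS](ger0_norm (normc_ge0 _)) -sqrtr_sqr.
  by rewrite ler_wsqrtr // (bigD1 j) //= lerDl sumr_ge0 // => i _; rewrite exprn_ge0.
apply: (@le_trans _ _ (\sum_(j < N) Normc.normc (A k j * x j ord0))).
  elim/big_ind2: _ => [|a b c d ab cd|//]; first by rewrite Normc.normc0.
  by apply: le_trans (lerD ab cd); exact: le_normcD.
by apply: ler_sum => j _; rewrite Normc.normcM ler_piMr.
Qed.

(* Main.v *)
(** For [beta != 0], the matrix [(alpha + beta z)I - (alpha I + beta A)] equals
    [beta (zI - A)], and the condition number is invariant under scaling by a
    nonzero scalar. For [beta = 0] the left-hand side is the condition spectrum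
    of [alpha I]: a nonzero scalar matrix has condition number at most
    [1 < 1 / eps], so only [alpha] remains. The right-hand side is then also
    [{alpha}] because [A] has an eigenvalue, so that its condition spectrum is
    nonempty. *)
Require Import Defs.
From mathcomp Require Import all_boot all_order all_algebra.
From mathcomp Require Import complex.
From mathcomp Require Import classical_sets reals.

Import Order.TTheory GRing.Theory Num.Theory.
Local Open Scope classical_set_scope.
Local Open Scope ring_scope.

Lemma normc_ge0 (R : rcfType) (z : R[i]) : 0 <= Normc.normc z.
Proof. by case: z => a b; exact: sqrtr_ge0. Qed.

Lemma enormZ (R : realType) (N : nat) (c : R[i]) (x : 'cV[R[i]]_N) :
  enorm (c *: x) = Normc.normc c * enorm x.
Proof.
rewrite /enorm -[in RHS](ger0_norm (normc_ge0 _ c)) -sqrtr_sqr.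
rewrite -sqrtrM ?sqr_ge0 // mulr_sumr; congr Num.sqrt.
by apply: eq_bigr => k _; rewrite mxE Normc.normcM exprMn.
Qed.

Lemma enorm_le_opnorm (R : realType) (N : nat) (A : 'M[R[i]]_N)
    (x : 'cV[R[i]]_N) :
  enorm x <= 1 -> enorm (A *m x) <= opnorm A.
Proof.
by move=> x1; apply: ub_le_sup; [case: (has_sup_opnorm A) | exists x].
Qed.

Lemma opnorm_le (R : realType) (N : nat) (A : 'M[R[i]]_N) (r : R) :
  (forall x : 'cV[R[i]]_N, enorm x <= 1 -> enorm (A *m x) <= r) ->
  opnorm A <= r.
Proof.
move=> Ar; apply: ge_sup; first by case: (has_sup_opnorm A).
by move=> _ [x /= x1 <-]; exact: Ar.
Qed.

Lemma opnorm_ge0 (R : realType) (N : nat) (A : 'M[R[i]]_N) : 0 <= opnorm A.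
Proof.
apply: le_trans (@enorm_le_opnorm _ _ A 0 _); first exact: sqrtr_ge0.
by rewrite -(scale0r 0) enormZ Normc.normc0 mul0r.
Qed.

Lemma opnormZ_le (R : realType) (N : nat) (c : R[i]) (A : 'M[R[i]]_N) :
  opnorm (c *: A) <= Normc.normc c * opnorm A.
Proof.
apply: opnorm_le => x x1; rewrite -scalemxAl enormZ ler_wpM2l ?normc_ge0 //.
exact: enorm_le_opnorm.
Qed.

Lemma opnormZ (R : realType) (N : nat) (c : R[i]) (A : 'M[R[i]]_N) :
  opnorm (c *: A) = Normc.normc c * opnorm A.
Proof.
apply/eqP; rewrite eq_le opnormZ_le /=.
have [->|c0] := eqVneq c 0; first by rewrite Normc.normc0 mul0r opnorm_ge0.
have nc_gt0 : 0 < Normc.normc c.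
  rewrite lt_neqAle normc_ge0 andbT eq_sym.
  by apply: contra_neq c0; exact: Normc.eq0_normc.
(* The reverse inequality is the one already proved, applied to [c^-1] and [c *: A], then multiplied
   by the positive modulus of [c]. *)
have := opnormZ_le _ _ c^-1 (c *: A).
by rewrite scalerA (mulVf c0) scale1r (Normc.normcV c) ler_pdivlMl.
Qed.

Lemma opnorm1_le1 (R : realType) (N : nat) :
  opnorm (1%:M : 'M[R[i]]_N) <= 1.
Proof. by apply: opnorm_le => x; rewrite mul1mx. Qed.

Lemma unitmxZ_neq0 (F : fieldType) (N : nat) (c : F) (B : 'M[F]_N) :
  c != 0 -> (c *: B \in unitmx) = (B \in unitmx).
Proof. by move=> c0; apply: unitmxZ; rewrite unitfE. Qed.

(** The moduli of [c^-1] and [c] cancel. Invertibility matters: [invmx] returns a singular matrix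
    unchanged, and the factor would then be the squared modulus of [c]. *)
Lemma cond_numberZ (R : realType) (N : nat) (c : R[i]) (B : 'M[R[i]]_N) :
  c != 0 -> B \in unitmx ->
  opnorm (invmx (c *: B)) * opnorm (c *: B) = opnorm (invmx B) * opnorm B.
Proof.
move=> c0 uB.
have ucB : c *: B \in unitmx by rewrite unitmxZ_neq0.
rewrite (invmxZ ucB) !opnormZ mulrACA (Normc.normcV c) mulVf; last first.
  by apply: contra_neq c0; exact: Normc.eq0_normc.
by rewrite mul1r.
Qed.

(** This is the membership condition of [cond_spectrum], with [r] in the role of [1 / eps]. *)
Lemma ill_conditionedZ (R : realType) (N : nat) (r : R) (c : R[i])
    (B : 'M[R[i]]_N) :
  c != 0 ->
  (c *: B \notin unitmx \/
     r <= opnorm (invmx (c *: B)) * opnorm (c *: B)) <->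
  (B \notin unitmx \/ r <= opnorm (invmx B) * opnorm B).
Proof.
move=> c0; rewrite (unitmxZ_neq0 _ _ _ _ c0).
have [uB|_] := boolP (B \in unitmx); last by split; left.
have E := cond_numberZ _ _ _ _ c0 uB.
by split=> -[|H]; [| right; rewrite -E| | right; rewrite E].
Qed.

Lemma cond_spectrum_affine_neq0 (R : realType) (N : nat) (eps : R)
    (A : 'M[R[i]]_N) (alpha beta z : R[i]) :
  beta != 0 ->
  cond_spectrum eps (alpha%:M + beta *: A) (alpha + beta * z) <->
  cond_spectrum eps A z.
Proof.
move=> b0; rewrite /cond_spectrum /=.
have -> : (alpha + beta * z)%:M - (alpha%:M + beta *: A) = beta *: (z%:M - A).
  by rewrite raddfD /= opprD addrACA subrr add0r scalerBr scale_scalar_mx.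
exact: ill_conditionedZ b0.
Qed.

Lemma cond_spectrum_scalar (R : realType) (N : nat) (eps : R) (alpha z : R[i]) :
  0 < eps -> eps < 1 -> cond_spectrum eps (alpha%:M : 'M_N) z -> z = alpha.
Proof.
(* The matrix becomes [(z - alpha) *: 1%:M]; if [z != alpha], it is invertible with the condition
   number of the identity. *)
move=> eps0 eps1; rewrite /cond_spectrum /= -raddfB /= -scalemx1 => sp.
apply/eqP; rewrite -subr_eq0; apply: contraT => za0.
case: sp => [|]; first by rewrite unitmxZ_neq0 // unitmx1.
rewrite cond_numberZ ?unitmx1 // invmx1 leNgt => /negP[].
apply: (@le_lt_trans _ _ 1); first by rewrite mulr_ile1 ?opnorm_ge0 ?opnorm1_le1.
by rewrite ltr_pdivlMr // mul1r.
Qed.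

Lemma eigenvalue_cond_spectrum (R : realType) (N : nat) (eps : R)
    (A : 'M[R[i]]_N) (z : R[i]) :
  eigenvalue A z -> cond_spectrum eps A z.
Proof.
rewrite /eigenvalue kermx_eq0 row_free_unit => sing; left.
(* [eigenvalue] speaks of [A - z%:M], which differs from [z%:M - A] by the factor [-1]. *)
by rewrite -opprB -scaleN1r unitmxZ_neq0 // oppr_eq0 oner_neq0.
Qed.

Theorem mainTheorem8 (R : realType) (N : nat) (hN : (1 <= N)%N)
    (A : 'M[R[i]]_N) (eps : R) (heps0 : 0 < eps) (heps1 : eps < 1)
    (alpha beta : R[i]) :
  cond_spectrum eps (alpha%:M + beta *: A) =
  [set alpha + beta * z | z in cond_spectrum eps A].
Proof.
have [->|b0] := eqVneq beta 0; last first.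
  apply/seteqP; split=> [w Hw|_ [z Hz <-]]; last exact/cond_spectrum_affine_neq0.
  (* The preimage of [w] under the affine map. *)
  have w_def : alpha + beta * (beta^-1 * (w - alpha)) = w.
    by rewrite mulVKf // addrC subrK.
  exists (beta^-1 * (w - alpha)); last exact: w_def.
  by apply/(cond_spectrum_affine_neq0 _ _ _ _ alpha _ _ b0); rewrite w_def.
rewrite scale0r addr0; apply/seteqP; split=> [w Hw|_ [z _ <-]].
  (* Any point of the condition spectrum of [A] maps to [alpha]; an eigenvalue provides one, as
     [R[i]] is algebraically closed and [N] is positive. *)
  have [a /eigenvalue_cond_spectrum Aa] := eigenvalue_closed A hN.
  exists a; first exact: Aa.
  by rewrite mul0r addr0 (cond_spectrum_scalar _ _ _ _ _ heps0 heps1 Hw).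
(* At [alpha] the matrix is zero, which is singular because [N] is positive; the empty matrix would
   be invertible. *)
left; rewrite mul0r addr0 subrr unitmxE.
by case: N hN A => // n _ _; rewrite det0 unitr0.
Qed.
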